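(* Let $e\ge 1$ and $r\ge 2$ be integers. The presentation $\mathcal{P}^{\oplus}(e,e,r)$ is a group presentation for the braid group $\mathbf{B}(e,e,r)$ (the generators $t_0,t_1,s_3,\dots,s_r$ being the generators of the same name of $\mathbf{B}(e,e,r)$, and the remaining generators corresponding to the elements $t_i=t_{i-1}t_{i-2}t_{i-1}^{-1}$, $2\le i\le e-1$, of $\mathbf{B}(e,e,r)$). Furthermore, adding to $\mathcal{P}^{\oplus}(e,e,r)$ the relations $a^2=1$ for all generators $a$ gives a presentation of the complex reflection group $\mathbf{G}(e,e,r)$, in which all the generators of the presentation are reflections.
   Context: The presentation $\mathcal{P}^{\oplus}(e,e,r)$ has generators $T_e\cup S_r$ with $T_e=\{t_i\mid i\in\mathbb{Z}/e\}$ and $S_r=\{s_3,\dots,s_r\}$ (empty if $r=2$), and relations: (R1) $s_is_js_i=s_js_is_j$ for $|i-j|=1$; (R2) $s_is_j=s_js_i$ for $|i-j|>1$; (R3) $s_3t_is_3=t_is_3t_i$ for $i\in\mathbb{Z}/e$; (R4) $s_jt_i=t_is_j$ for $i\in\mathbb{Z}/e$ and $4\le j\le r$; (R5) $t_it_{i-1}=t_jt_{j-1}$ for $i,j\in\mathbb{Z}/e$. Relations involving $s_j$ occur only when $3\le j\le r$. $\mathbf{G}(e,e,r)$ is the group of $r\times r$ monomial matrices over $\mathbb{C}$ (exactly one non-zero entry in each row and column) whose non-zero entries are $e$-th roots of unity with product $1$. A reflection is a non-trivial element of this group fixing a hyperplane of $\mathbb{C}^r$ pointwise. The braid group $\mathbf{B}(e,e,r)$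 is the fundamental group of the space of regular orbits of $\mathbf{G}(e,e,r)$ (the quotient by $\mathbf{G}(e,e,r)$ of the complement in $\mathbb{C}^r$ of the reflecting hyperplanes). As starting point one uses the following presentation of Broué–Malle–Rouquier (which may be taken as the definition): generators $t_0,t_1,s_3,\dots,s_r$, and relations (R1), (R2) on the $s_j$ together with: $\langle t_1t_0\rangle^e=\langle t_0t_1\rangle^e$; $s_3t_is_3=t_is_3t_i$ for $i=0,1$; $s_jt_i=t_is_j$ for $i=0,1$ and $4\le j\le r$; $(s_3t_1t_0)^2=(t_1t_0s_3)^2$. Here $\langle ab\rangle^e$ denotes the alternating product $aba\cdots$ with $e$ factors beginning with $a$. It is known (Broué–Malle–Rouquier) that adding the relations $a^2=1$ for all generators $a$ to this presentation gives a presentation of $\mathbf{G}(e,e,r)$ in which the generators are reflections. *)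

(* Defs.v *)
From HB Require Import structures.
From mathcomp Require Import all_boot all_order all_algebra all_fingroup.
From mathcomp Require Import generic_quotient.
From mathcomp Require Import boolp reals.
From mathcomp Require Import complex.

Set Implicit Arguments.
Unset Strict Implicit.
Unset Printing Implicit Defensive.

Import GRing.Theory.

Local Open Scope nat_scope.

(* The letter (x, true) stands for x and (x, false) for its inverse. *)
Definition word (X : Type) := seq (X * bool).

(* A set of defining relations u = v between positive words; all the
   presentations below are of this form, but they present groups. *)
Definition relations (X : Type) := seq X -> seq X -> Prop.

Definition pos_word (X : Type) (u : seq X) : word X := [seq (x, true) | x <- u].

(* Equality in the group < X | R >. *)
Inductive pres_eq (X : Type) (R : relations X) : word X -> word X -> Prop :=
| pres_refl u : pres_eq R u u
| pres_sym u v : pres_eq R u v -> pres_eq R v u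
| pres_trans u v w : pres_eq R u v -> pres_eq R v w -> pres_eq R u w
| pres_cancel p q x b :
    pres_eq R (p ++ [:: (x, b); (x, ~~ b)] ++ q) (p ++ q)
| pres_rel p q u v : R u v ->
    pres_eq R (p ++ pos_word u ++ q) (p ++ pos_word v ++ q).

Definition word_eval (X : Type) (G : groupType) (f : X -> G) (w : word X) : G :=
  (\prod_(l <- w) (if l.2 then f l.1 else (f l.1)^-1))%g.

(* < X | R > is a presentation of G, the generator x being f x: the induced map
   from the free group on X to G is onto, and its kernel is the normal closure
   of the relators. *)
Definition is_presentation (X : Type) (R : relations X) (G : groupType)
    (f : X -> G) : Prop :=
  (forall g : G, exists w : word X, word_eval f w = g) /\
  (forall u v : word X, word_eval f u = word_eval f v <-> pres_eq R u v).

Definition add_squares (X : Type) (R : relations X) : relations X :=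
  fun u v => R u v \/ exists a : X, u = [:: a; a] /\ v = [::].

Lemma pres_ctx (X : Type) (R : relations X) p q u v :
  pres_eq R u v -> pres_eq R (p ++ u ++ q) (p ++ v ++ q).
Proof.
elim=> {u v} [u|u v _|u v w _ IH1 _ IH2|p' q' x b|p' q' u v Ruv].
- exact: pres_refl.
- exact: pres_sym.
- exact: pres_trans IH1 IH2.
- have := pres_cancel R (p ++ p') (q' ++ q) x b.
  by rewrite -!catA.
- have := pres_rel (p ++ p') (q' ++ q) Ruv.
  by rewrite -!catA.
Qed.

Lemma pres_cat (X : Type) (R : relations X) u u' v v' :
  pres_eq R u u' -> pres_eq R v v' -> pres_eq R (u ++ v) (u' ++ v').
Proof.
move=> Hu Hv; apply: (@pres_trans _ _ _ (u' ++ v)).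
  exact: (pres_ctx [::] v Hu).
by have := pres_ctx u' [::] Hv; rewrite !cats0.
Qed.

Definition word_inv (X : Type) (w : word X) : word X :=
  rev [seq (l.1, ~~ l.2) | l <- w].

Lemma word_inv_cat (X : Type) (u v : word X) :
  word_inv (u ++ v) = word_inv v ++ word_inv u.
Proof. by rewrite /word_inv map_cat rev_cat. Qed.

Lemma word_invK (X : Type) : involutive (@word_inv X).
Proof.
move=> w; rewrite /word_inv map_rev revK -map_comp -[RHS]map_id.
by apply: eq_map => -[x b] /=; rewrite negbK.
Qed.

Lemma pres_invr (X : Type) (R : relations X) (w : word X) :
  pres_eq R (w ++ word_inv w) [::].
Proof.
elim: w => [|[x b] w IH]; first exact: pres_refl.
rewrite /word_inv /= rev_cons -cats1 -/(word_inv w).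
have := pres_ctx [:: (x, b)] [:: (x, ~~ b)] IH; rewrite /= -catA => H.
by apply: pres_trans H _; exact: (pres_cancel R [::] [::]).
Qed.

Lemma pres_invl (X : Type) (R : relations X) (w : word X) :
  pres_eq R (word_inv w ++ w) [::].
Proof. by rewrite -{2}[w]word_invK; exact: pres_invr. Qed.

Lemma pres_inv (X : Type) (R : relations X) u v :
  pres_eq R u v -> pres_eq R (word_inv u) (word_inv v).
Proof.
move=> Huv; apply: (@pres_trans _ _ _ (word_inv u ++ (v ++ word_inv v))).
  have := pres_ctx (word_inv u) [::] (pres_sym (pres_invr R v)).
  by rewrite !cats0.
rewrite catA; apply: (@pres_trans _ _ _ ([::] ++ word_inv v)); last first.
  exact: pres_refl.
apply: pres_cat; last exact: pres_refl.
apply: (@pres_trans _ _ _ (word_inv u ++ u)); last exact: pres_invl.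
by apply: pres_cat; [exact: pres_refl | exact: pres_sym].
Qed.

Section Presented.
Variables (X : choiceType) (R : relations X).

Definition pres_eqb : rel (word X) := fun u v => `[< pres_eq R u v >].

Lemma pres_eqb_equiv : equiv_class_of pres_eqb.
Proof.
split=> [u|u v|v u w].
- by apply/asboolP; exact: pres_refl.
- by apply/asboolP/asboolP => H; exact: pres_sym.
- by move=> /asboolP H1 /asboolP H2; apply/asboolP; exact: pres_trans H1 H2.
Qed.

Canonical pres_equiv_rel := EquivRelPack pres_eqb_equiv.

Definition presented : Type := {eq_quot pres_equiv_rel}%qT.

HB.instance Definition _ := Choice.on presented.
HB.instance Definition _ := EqQuotient.on presented.

Definition presented_class (w : word X) : presented := (\pi_presented w)%qT.

Lemma presented_classP (u v : word X) :
  presented_class u = presented_class v <-> pres_eq R u v.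
Proof.
split=> [/eqquotP /asboolP //| H]; by apply/eqquotP/asboolP.
Qed.

Lemma repr_presented (a : presented) : presented_class (repr a) = a.
Proof. exact: reprK. Qed.

Definition presented_mul (a b : presented) : presented :=
  presented_class (repr a ++ repr b).
Definition presented_inv (a : presented) : presented :=
  presented_class (word_inv (repr a)).

Lemma presented_reprK (u : word X) : pres_eq R (repr (presented_class u)) u.
Proof. by apply/presented_classP; rewrite repr_presented. Qed.

Lemma presented_mulE (u v : word X) :
  presented_mul (presented_class u) (presented_class v)
  = presented_class (u ++ v).
Proof. by apply/presented_classP; apply: pres_cat; exact: presented_reprK. Qed.

Lemma presented_invE (u : word X) :
  presented_inv (presented_class u) = presented_class (word_inv u).
Proof. by apply/presented_classP; apply: pres_inv; exact: presented_reprK. Qed.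

Fact presented_mulA : associative presented_mul.
Proof.
move=> a b c; rewrite -[a]repr_presented -[b]repr_presented -[c]repr_presented.
by rewrite !presented_mulE catA.
Qed.

Fact presented_mul1g : left_id (presented_class [::]) presented_mul.
Proof. by move=> a; rewrite -[a]repr_presented presented_mulE. Qed.

Fact presented_mulg1 : right_id (presented_class [::]) presented_mul.
Proof. by move=> a; rewrite -[a]repr_presented presented_mulE cats0. Qed.

Fact presented_mulVg :
  left_inverse (presented_class [::]) presented_inv presented_mul.
Proof.
move=> a; rewrite -[a]repr_presented presented_invE presented_mulE.
by apply/presented_classP; exact: pres_invl.
Qed.

Fact presented_mulgV :
  right_inverse (presented_class [::]) presented_inv presented_mul.
Proof.
move=> a; rewrite -[a]repr_presented presented_invE presented_mulE.
by apply/presented_classP; exact: pres_invr.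
Qed.

HB.instance Definition _ := isGroup.Build presented presented_mulA
  presented_mul1g presented_mulg1 presented_mulVg presented_mulgV.

Definition presented_gen (x : X) : presented := presented_class [:: (x, true)].

Lemma word_eval_presented (w : word X) :
  word_eval presented_gen w = presented_class w.
Proof.
rewrite /word_eval; elim: w => [|[x b] w IH]; first by rewrite big_nil.
rewrite big_cons IH /=; case: b.
  exact: presented_mulE [:: (x, true)] w.
rewrite (_ : (presented_gen x)^-1%g = presented_class [:: (x, false)]).
  exact: presented_mulE [:: (x, false)] w.
exact: presented_invE.
Qed.

Lemma presented_is_presentation : is_presentation R presented_gen.
Proof.
split=> [g | u v]; last by rewrite !word_eval_presented; exact: presented_classP.
by exists (repr g); rewrite word_eval_presented repr_presented.
Qed.

End Presented.

Definition sidx (r : nat) := {j : nat | 3 <= j <= r}.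

(* Z/e is the type 'I_e of residues, with i - 1 being the cyclic predecessor
   [ord_pred i]; contrary to 'Z_e, this is also right for e = 1. *)
Inductive oplus_gen (e r : nat) : Type :=
| oplus_t of 'I_e
| oplus_s of sidx r.
Arguments oplus_t {e} r.
Arguments oplus_s e {r}.

Inductive oplus_rel (e r : nat) : relations (oplus_gen e r) :=
| oplus_R1 (i j : sidx r) : `|val i - val j| = 1 ->
    oplus_rel [:: oplus_s e i; oplus_s e j; oplus_s e i]
              [:: oplus_s e j; oplus_s e i; oplus_s e j]
| oplus_R2 (i j : sidx r) : 1 < `|val i - val j| ->
    oplus_rel [:: oplus_s e i; oplus_s e j] [:: oplus_s e j; oplus_s e i]
| oplus_R3 (j : sidx r) (i : 'I_e) : val j = 3 ->
    oplus_rel [:: oplus_s e j; oplus_t r i; oplus_s e j]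
              [:: oplus_t r i; oplus_s e j; oplus_t r i]
| oplus_R4 (j : sidx r) (i : 'I_e) : 4 <= val j ->
    oplus_rel [:: oplus_s e j; oplus_t r i] [:: oplus_t r i; oplus_s e j]
| oplus_R5 (i j : 'I_e) :
    oplus_rel [:: oplus_t r i; oplus_t r (ord_pred i)]
              [:: oplus_t r j; oplus_t r (ord_pred j)].

Inductive bmr_gen (r : nat) : Type :=
| bmr_t0
| bmr_t1
| bmr_s of sidx r.
Arguments bmr_t0 {r}.
Arguments bmr_t1 {r}.

Fixpoint alt_word (X : Type) (a b : X) (n : nat) : seq X :=
  if n is n'.+1 then a :: alt_word b a n' else [::].

Definition bmr_t (r : nat) (i : bool) : bmr_gen r :=
  if i then bmr_t1 else bmr_t0.

Inductive bmr_rel (e r : nat) : relations (bmr_gen r) :=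
| bmr_R1 (i j : sidx r) : `|val i - val j| = 1 ->
    bmr_rel e [:: bmr_s i; bmr_s j; bmr_s i] [:: bmr_s j; bmr_s i; bmr_s j]
| bmr_R2 (i j : sidx r) : 1 < `|val i - val j| ->
    bmr_rel e [:: bmr_s i; bmr_s j] [:: bmr_s j; bmr_s i]
| bmr_tt :
    bmr_rel e (alt_word bmr_t1 bmr_t0 e) (alt_word bmr_t0 bmr_t1 e)
| bmr_st3 (j : sidx r) (i : bool) : val j = 3 ->
    bmr_rel e [:: bmr_s j; bmr_t r i; bmr_s j]
              [:: bmr_t r i; bmr_s j; bmr_t r i]
| bmr_st4 (j : sidx r) (i : bool) : 4 <= val j ->
    bmr_rel e [:: bmr_s j; bmr_t r i] [:: bmr_t r i; bmr_s j]
| bmr_stt (j : sidx r) : val j = 3 ->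
    bmr_rel e [:: bmr_s j; bmr_t1; bmr_t0; bmr_s j; bmr_t1; bmr_t0]
              [:: bmr_t1; bmr_t0; bmr_s j; bmr_t1; bmr_t0; bmr_s j].

Definition bmr_gen_code (r : nat) (x : bmr_gen r) : bool + sidx r :=
  match x with
  | bmr_t0 => inl false
  | bmr_t1 => inl true
  | bmr_s j => inr j
  end.

Definition bmr_gen_decode (r : nat) (y : bool + sidx r) : bmr_gen r :=
  match y with inl i => bmr_t r i | inr j => bmr_s j end.

Lemma bmr_gen_codeK (r : nat) : cancel (@bmr_gen_code r) (@bmr_gen_decode r).
Proof. by case. Qed.

HB.instance Definition _ (r : nat) :=
  Choice.copy (bmr_gen r) (can_type (@bmr_gen_codeK r)).

(* The Broue-Malle-Rouquier presentation is taken as the definition of the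
   fundamental group of the space of regular orbits of G(e,e,r). *)
Definition braid_group (e r : nat) : groupType := presented (@bmr_rel e r).

Definition braid_gen (e r : nat) (x : bmr_gen r) : braid_group e r :=
  presented_gen (@bmr_rel e r) x.

Section ReflectionGroup.
Local Open Scope ring_scope.

Definition monomial_mx (C : fieldType) (r : nat) (A : 'M[C]_r) : bool :=
  [forall i, #|[pred j | A i j != 0]| == 1%N] &&
  [forall j, #|[pred i | A i j != 0]| == 1%N].

Definition in_Geer (C : fieldType) (e r : nat) (A : 'M[C]_r) : bool :=
  [&& monomial_mx A,
      [forall i, forall j, (A i j != 0) ==> e.-unity_root (A i j)] &
      \prod_i \prod_(j | A i j != 0) A i j == 1].

Variables (C : fieldType) (e r : nat).
Implicit Types A B : 'M[C]_r.

Definition mono_mx (s : 'S_r) (d : 'I_r -> C) : 'M[C]_r :=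
  \matrix_(i, j) (if j == s i then d i else 0).

Lemma in_GeerP A :
  reflect (exists s : 'S_r, exists d : 'I_r -> C,
    [/\ A = mono_mx s d, forall i, d i != 0, forall i, d i ^+ e = 1 &
        \prod_i d i = 1])
  (in_Geer e A).
Proof.
apply: (iffP and3P) => [[/andP[/forallP rowA /forallP colA] rootA prodA]|].
  have /fin_all_exists[f fP] : forall i, exists j,
      forall k, (A i k != 0) = (k == j).
    move=> i; have /eqP/mem_card1[j Hj] := rowA i.
    by exists j => k; have := Hj k; rewrite !inE.
  have f_inj : injective f.
    move=> i i' eq_f; have /eqP/mem_card1[k Hk] := colA (f i).
    have := Hk i; have := Hk i'; rewrite !inE fP -eq_f eqxx fP eqxx.
    by move=> /esym/eqP-> /esym/eqP->.
  exists (perm f_inj), (fun i => A i (f i)).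
  split=> [|i|i|].
  - apply/matrixP=> i j; rewrite !mxE permE; case: eqP => [-> //|/eqP].
    by rewrite -fP negbK => /eqP.
  - by rewrite fP.
  - move/forallP/(_ i)/forallP/(_ (f i)): rootA.
    by rewrite fP eqxx /= unity_rootE => /eqP.
  - apply: etrans (eqP prodA); apply: eq_bigr => i _.
    by rewrite (eq_bigl (pred1 (f i))) ?big_pred1_eq // => j; rewrite fP.
case=> s [d [-> d0 dr dp]].
have E i j : (mono_mx s d i j != 0) = (j == s i).
  by rewrite mxE; case: ifP => _; rewrite ?d0 ?eqxx.
split.
- apply/andP; split; apply/forallP => i.
    by rewrite (eq_card (B := pred1 (s i))) ?card1 // => j; rewrite !inE E.
  rewrite (eq_card (B := pred1 ((s^-1)%g i))) ?card1 // => j; rewrite !inE E.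
  by rewrite -(can2_eq (permK s) (permKV s)) eq_sym.
- apply/forallP => i; apply/forallP => j; rewrite E; apply/implyP => /eqP ->.
  by rewrite unity_rootE mxE eqxx dr.
- apply/eqP; apply: etrans dp; apply: eq_bigr => i _.
  by rewrite (eq_bigl (pred1 (s i))) ?big_pred1_eq ?mxE ?eqxx // => j; rewrite E.
Qed.

Lemma mono_mxM s s' d d' :
  mono_mx s d *m mono_mx s' d' = mono_mx (s * s')%g (fun i => d i * d' (s i)).
Proof.
apply/matrixP=> i j; rewrite !mxE (bigD1 (s i)) //= big1 => [|k /negbTE ki].
  by rewrite !mxE eqxx permM addr0; case: ifP; rewrite ?mulr0.
by rewrite mxE ki mul0r.
Qed.

Lemma mono_mx1 : mono_mx 1%g (fun=> 1) = 1%:M.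
Proof. by apply/matrixP=> i j; rewrite !mxE perm1 eq_sym; case: eqP. Qed.

Lemma Geer_mulmx A B : in_Geer e A -> in_Geer e B -> in_Geer e (A *m B).
Proof.
move=> /in_GeerP[s [d [-> d0 dr dp]]] /in_GeerP[s' [d' [-> d0' dr' dp']]].
apply/in_GeerP; exists (s * s')%g, (fun i => d i * d' (s i)); split.
- exact: mono_mxM.
- by move=> i; rewrite mulf_neq0.
- by move=> i; rewrite exprMn dr dr' mulr1.
- rewrite big_split /= dp mul1r; apply: etrans dp'.
  by rewrite [RHS](reindex_inj (@perm_inj _ s)).
Qed.

Lemma Geer_1mx : in_Geer e (1%:M : 'M[C]_r).
Proof.
apply/in_GeerP; exists 1%g, (fun=> 1); rewrite mono_mx1.
split=> [//|i|i|]; [exact: oner_neq0 | exact: expr1n | exact: big1].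
Qed.

Lemma Geer_invP A : in_Geer e A -> exists2 B, in_Geer e B & A *m B = 1%:M.
Proof.
move=> /in_GeerP[s [d [-> d0 dr dp]]].
exists (mono_mx s^-1%g (fun i => (d ((s^-1)%g i))^-1)).
  apply/in_GeerP; exists s^-1%g, (fun i => (d ((s^-1)%g i))^-1).
  split=> // [i|i|]; first by rewrite invr_eq0.
    by rewrite exprVn dr invr1.
  rewrite prodfV; apply: (canLR invrK); rewrite invr1; apply: etrans dp.
  by rewrite [RHS](reindex_inj (@perm_inj _ s^-1%g)).
rewrite mono_mxM mulgV -mono_mx1; apply/matrixP=> i j; rewrite !mxE permK.
by rewrite mulfV.
Qed.

Lemma Geer_unitmx A : in_Geer e A -> A \in unitmx.
Proof. by move=> /Geer_invP[B _ /mulmx1_unit[]]. Qed.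

Lemma Geer_invmx A : in_Geer e A -> in_Geer e (invmx A).
Proof.
move=> GA; have [B GB AB] := Geer_invP GA.
suff -> : invmx A = B by [].
by rewrite -[B]mul1mx -(mulVmx (Geer_unitmx GA)) -mulmxA AB mulmx1.
Qed.

Record Geer : Type := MkGeer { Geer_mx :> 'M[C]_r; _ : in_Geer e Geer_mx }.

HB.instance Definition _ := [isSub for Geer_mx].
HB.instance Definition _ := [Choice of Geer by <:].

Lemma GeerP (g : Geer) : in_Geer e g. Proof. exact: valP. Qed.

Definition Geer_mul (g h : Geer) : Geer := MkGeer (Geer_mulmx (GeerP g) (GeerP h)).
Definition Geer_one : Geer := MkGeer Geer_1mx.
Definition Geer_inv (g : Geer) : Geer := MkGeer (Geer_invmx (GeerP g)).

Fact Geer_mulA : associative Geer_mul.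
Proof. by move=> a b c; apply: val_inj; rewrite /= mulmxA. Qed.
Fact Geer_mul1g : left_id Geer_one Geer_mul.
Proof. by move=> a; apply: val_inj; rewrite /= mul1mx. Qed.
Fact Geer_mulg1 : right_id Geer_one Geer_mul.
Proof. by move=> a; apply: val_inj; rewrite /= mulmx1. Qed.
Fact Geer_mulVg : left_inverse Geer_one Geer_inv Geer_mul.
Proof. by move=> a; apply: val_inj; rewrite /= mulVmx // Geer_unitmx ?GeerP. Qed.
Fact Geer_mulgV : right_inverse Geer_one Geer_inv Geer_mul.
Proof. by move=> a; apply: val_inj; rewrite /= mulmxV // Geer_unitmx ?GeerP. Qed.

HB.instance Definition _ := isGroup.Build Geer Geer_mulA
  Geer_mul1g Geer_mulg1 Geer_mulVg Geer_mulgV.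

Definition is_reflection (g : Geer) : Prop :=
  g <> 1%g /\
  exists H : {vspace 'cV[C]_r},
    (\dim H).+1 = r /\ (forall v : 'cV[C]_r, v \in H -> Geer_mx g *m v = v).

End ReflectionGroup.

(* R is any model of the real numbers, so that R[i] is the field C. *)
Definition reflection_group (R : realType) (e r : nat) : groupType :=
  Geer R[i] e r.

(* Main.v *)
(* Braid group.  Extend [t_0, t_1] to a sequence by [t_(n+2) = t_(n+1) t_n
   t_(n+1)^-1], so that [t_(n+1) t_n] is a constant [D].  The alternating relation
   of length [e] between [t_0] and [t_1] is then equivalent to [t_e = t_0], hence to
   [e]-periodicity, and [(s_3 D)^2 = (D s_3)^2] is equivalent to the braid relation
   between [s_3] and [t_2], which propagates to all [t_i] along the sequence.

   Reflection group.  Modulo squares [t_a = D^a t_0].  The matrix group acts on the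
   multiples of the coordinate vectors by roots of unity; moving the last vector by
   explicit coset representatives gives, by induction on the number of coordinates
   that are not fixed, both surjectivity and injectivity of the map from the
   presented group, the relations being used only to rewrite a generator times a
   representative as a representative times an element of the smaller subgroup. *)
From HB Require Import structures.
Require Import Defs.
From mathcomp Require Import all_boot all_order all_algebra.
From mathcomp Require Import all_fingroup generic_quotient zify ring.
From mathcomp Require Import cyclic separable cyclotomic.
From mathcomp Require Import reals complex.

Set Implicit Arguments.
Unset Strict Implicit.
Unset Printing Implicit Defensive.

Import GRing.Theory Num.Theory.

Local Open Scope nat_scope.
Local Open Scope group_scope.

(** * Evaluation of words and homomorphisms out of a presented group *)

Section WordEval.
Variables (X : Type) (G : groupType) (f : X -> G).

Lemma word_eval_cat (u v : word X) :
  word_eval f (u ++ v) = word_eval f u * word_eval f v.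
Proof. by rewrite /word_eval big_cat. Qed.

Lemma word_eval_letter (l : X * bool) :
  word_eval f [:: l] = if l.2 then f l.1 else (f l.1)^-1.
Proof. by rewrite /word_eval big_seq1. Qed.

Lemma word_eval_pos (u : seq X) : word_eval f (pos_word u) = \prod_(x <- u) f x.
Proof. by rewrite /word_eval big_map. Qed.

Definition satisfies (R : relations X) : Prop :=
  forall u v, R u v -> \prod_(x <- u) f x = \prod_(x <- v) f x.

Lemma word_eval_pres (R : relations X) (u v : word X) :
  satisfies R -> pres_eq R u v -> word_eval f u = word_eval f v.
Proof.
move=> fR; elim=> {u v} [//|//|u v w _ -> _ //|p q x b|p q u v Ruv].
- rewrite !word_eval_cat -[in [:: _; _]]cat1s word_eval_cat !word_eval_letter.
  by case: b; rewrite /= ?mulgV ?mulVg mul1g.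
- by rewrite !word_eval_cat !word_eval_pos (fR _ _ Ruv).
Qed.

End WordEval.

Lemma word_eval_morph (X : Type) (G H : groupType) (phi : G -> H)
    (phiM : {morph phi : x y / x * y}) (f : X -> G) (w : word X) :
  phi (word_eval f w) = word_eval (phi \o f) w.
Proof.
have phi1 : phi 1 = 1 by apply: (mulgI (phi 1)); rewrite -phiM !mulg1.
have phiV x : phi x^-1 = (phi x)^-1.
  by apply: (mulgI (phi x)); rewrite -phiM !mulgV.
elim: w => [|l w IH]; first by rewrite /word_eval !big_nil.
rewrite -cat1s !word_eval_cat phiM IH !word_eval_letter.
by case: (l.2); rewrite /= ?phiV.
Qed.

Section PresentedLift.
Variables (X : choiceType) (R : relations X).

Lemma presented_satisfies : satisfies (presented_gen R) R.
Proof.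
move=> u v Ruv; rewrite -!word_eval_pos !word_eval_presented.
by apply/presented_classP; have := pres_rel [::] [::] Ruv; rewrite !cats0.
Qed.

Lemma presented_word (q : presented R) :
  exists w : word X, q = word_eval (presented_gen R) w.
Proof. by exists (repr q); rewrite word_eval_presented repr_presented. Qed.

Variables (G : groupType) (f : X -> G).
Hypothesis fR : satisfies f R.

(** The value is read off a chosen representative word; [presented_lift_word] shows that, [f]
    satisfying [R], every other word of the class gives the same value. *)
Definition presented_lift (q : presented R) : G := word_eval f (repr q).

Lemma presented_lift_word (w : word X) :
  presented_lift (word_eval (presented_gen R) w) = word_eval f w.
Proof.
rewrite word_eval_presented; apply: word_eval_pres fR _.
exact: presented_reprK.
Qed.

Lemma presented_liftM : {morph presented_lift : x y / x * y}.
Proof.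
move=> x y; have [u ->] := presented_word x; have [v ->] := presented_word y.
by rewrite -word_eval_cat !presented_lift_word word_eval_cat.
Qed.

Lemma presented_lift1 : presented_lift 1 = 1.
Proof. by apply: (mulgI (presented_lift 1)); rewrite -presented_liftM !mulg1. Qed.

Lemma presented_liftV (x : presented R) :
  presented_lift x^-1 = (presented_lift x)^-1.
Proof.
apply: (mulgI (presented_lift x)).
by rewrite -presented_liftM !mulgV presented_lift1.
Qed.

Lemma presented_lift_gen (x : X) : presented_lift (presented_gen R x) = f x.
Proof.
by have := presented_lift_word [:: (x, true)]; rewrite !word_eval_letter.
Qed.

(** Two words with equal values have a quotient in the kernel of the lift, so a trivial kernel is
    enough for the second half of [is_presentation]. *)
Lemma presentation_of_lift :
  (forall g, exists q, presented_lift q = g) ->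
  (forall q, presented_lift q = 1 -> q = 1) -> is_presentation R f.
Proof.
move=> surj inj; split=> [g|u v].
  have [q <-] := surj g; have [w ->] := presented_word q.
  by exists w; rewrite presented_lift_word.
split=> [Euv|]; last exact: word_eval_pres fR.
apply/presented_classP; rewrite -!word_eval_presented; apply: divg1_eq; apply: inj.
by rewrite presented_liftM presented_liftV !presented_lift_word Euv mulgV.
Qed.

End PresentedLift.

(** A composite of the two lifts is the identity as soon as it is so on generators; one composite
    gives surjectivity, the other a trivial kernel. *)
Lemma presentation_of_inverse (X Y : choiceType) (R : relations X)
    (S : relations Y) (f : X -> presented S) (g : Y -> presented R) :
  satisfies f R -> satisfies g S ->
  (forall x, presented_lift g (f x) = presented_gen R x) ->
  (forall y, presented_lift f (g y) = presented_gen S y) ->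
  is_presentation R f.
Proof.
move=> fR gS gf fg; apply: (presentation_of_lift fR) => [q | q].
  exists (presented_lift g q); have [w ->] := presented_word q.
  rewrite presented_lift_word // (word_eval_morph (presented_liftM fR)).
  by apply: eq_bigr => l _; rewrite /= fg.
have [w ->] := presented_word q; rewrite presented_lift_word // => fw1.
have : presented_lift g (word_eval f w) = 1 by rewrite fw1 presented_lift1.
rewrite (word_eval_morph (presented_liftM gS)) => <-.
by apply: eq_bigr => l _; rewrite /= gf.
Qed.

(** * Sequences whose consecutive products are constant *)

(* With [D = T (n.+1) * T n] constant, the alternating word in [T 1] and [T 0]
   satisfies [P (n.+2) = D * P n], hence [P (n.+1) = T (n.+1) * P n], to be
   compared with the other alternating word [T 0 * P n]. *)
Section DualSequence.
Variables (G : groupType) (T : nat -> G) (D : G).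
Hypothesis TT : forall n, T n.+1 * T n = D.

Definition alt_prod (a b : G) (n : nat) : G := \prod_(x <- alt_word a b n) x.

Lemma alt_prodS (a b : G) (n : nat) : alt_prod a b n.+1 = a * alt_prod b a n.
Proof. by rewrite /alt_prod /= big_cons. Qed.

Lemma alt_prod_dual (n : nat) :
  alt_prod (T 1%N) (T 0%N) n.+1 = T n.+1 * alt_prod (T 1%N) (T 0%N) n.
Proof.
elim: n => [|n IH]; first by rewrite alt_prodS /alt_prod /= !big_nil.
by rewrite alt_prodS alt_prodS mulgA TT -(TT n.+1) -mulgA -IH.
Qed.

Lemma alt_prod_eq (n : nat) : 0 < n ->
  alt_prod (T 1%N) (T 0%N) n = alt_prod (T 0%N) (T 1%N) n <-> T n = T 0%N.
Proof.
case: n => // n _; rewrite alt_prod_dual (alt_prodS (T 0%N)).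
by split=> [/mulIg|->].
Qed.

Lemma dualS (n : nat) : T n.+1 = D * (T n)^-1.
Proof. by rewrite -(TT n) mulgK. Qed.

(** By [dualS] each term determines the next, so a single return to [T 0] repeats the whole
    sequence. *)
Lemma dual_periodic (e : nat) : T e = T 0%N -> forall n, T (n + e) = T n.
Proof. by move=> Te; elim=> [//|n IH]; rewrite addSn !dualS IH. Qed.

Lemma dual_modn (e : nat) : T e = T 0%N -> forall n, T (n %% e) = T n.
Proof.
move=> Te n; rewrite {2}(divn_eq n e) addnC.
elim: (n %/ e) => [|k IH]; first by rewrite mul0n addn0.
by rewrite mulSn addnCA addnC dual_periodic.
Qed.

Lemma dual_commute (s : G) :
  commute s (T 0%N) -> commute s (T 1%N) -> forall n, commute s (T n).
Proof.
move=> s0 s1; have sD : commute s D by rewrite -(TT 0); apply: commuteM.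
by elim=> [//|n IH]; rewrite dualS; apply: commuteM => //; apply: commuteV.
Qed.

(** With [c = a * b * a^-1] one has [c * a = a * b], and the first equality becomes [s * c * s * (a
    * s * b) = c * s * c * (a * s * b)]; cancel the common factor. For [a = T n.+1] and [b = T n],
    [c] is [T n.+2]. *)
Lemma braid_dual_step (s a b : G) :
  s * a * s = a * s * a -> s * b * s = b * s * b ->
  (s * (a * b)) * (s * (a * b)) = (a * b * s) * (a * b * s) <->
  s * (a * b * a^-1) * s = (a * b * a^-1) * s * (a * b * a^-1).
Proof.
move=> sa sb; set c := a * b * a^-1.
have saX x : x * s * a * s = x * a * s * a.
  by have := congr1 (fun y => x * y) sa; rewrite !mulgA.
have sbX x : x * s * b * s = x * b * s * b.
  by have := congr1 (fun y => x * y) sb; rewrite !mulgA.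
have -> : s * (a * b) * (s * (a * b)) = s * c * s * (a * s * b).
  by rewrite /c !mulgA saX mulgVK.
have -> : a * b * s * (a * b * s) = c * s * c * (a * s * b).
  by rewrite /c !mulgA mulgVK -sbX saX mulgVK.
by split=> [/mulIg|->].
Qed.

(** Since every [T n.+1 * T n] is [D], the hypothesis on [D] is the first equality of
    [braid_dual_step] at every [n]; hence an induction on pairs of consecutive terms. *)
Lemma dual_braid (s : G) :
  s * T 0%N * s = T 0%N * s * T 0%N -> s * T 1%N * s = T 1%N * s * T 1%N ->
  (s * D) * (s * D) = (D * s) * (D * s) ->
  forall n, s * T n * s = T n * s * T n.
Proof.
move=> s0 s1 sD.
suff H n : s * T n * s = T n * s * T n /\ s * T n.+1 * s = T n.+1 * s * T n.+1.
  by move=> n; have [] := H n.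
elim: n => [//|n [IH0 IH1]]; split=> //.
by have := (braid_dual_step IH1 IH0).1; rewrite TT -dualS; apply.
Qed.

End DualSequence.

(** * The braid group *)

(** The sum type transports a choice structure to the generators, as [presented] requires. *)
Definition oplus_gen_code (e r : nat) (x : oplus_gen e r) : 'I_e + sidx r :=
  match x with oplus_t i => inl i | oplus_s j => inr j end.

Definition oplus_gen_decode (e r : nat) (y : 'I_e + sidx r) : oplus_gen e r :=
  match y with inl i => oplus_t r i | inr j => oplus_s e j end.

Lemma oplus_gen_codeK (e r : nat) :
  cancel (@oplus_gen_code e r) (@oplus_gen_decode e r).
Proof. by case. Qed.

HB.instance Definition _ (e r : nat) :=
  Choice.copy (oplus_gen e r) (can_type (@oplus_gen_codeK e r)).

Lemma dual_sequence_exists (G : groupType) (a b : G) :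
  exists T : nat -> G, [/\ T 0%N = a, T 1%N = b &
    forall n, T n.+2 = T n.+1 * T n * (T n.+1)^-1].
Proof.
(* Iterating on pairs of consecutive terms turns the second-order recursion into a first-order
   one. *)
pose step (p : G * G) := (p.2, p.2 * p.1 * p.2^-1).
exists (fun n => (iter n step (a, b)).1); by split.
Qed.

Lemma ordS_modn (e n : nat) (he : 0 < e) :
  ordS (Ordinal (ltn_pmod n he)) = Ordinal (ltn_pmod n.+1 he).
Proof. by apply: val_inj; rewrite /= -addn1 modnDml addn1. Qed.

Lemma val_ord_pred (e : nat) (i : 'I_e) : 0 < i -> ord_pred i = i.-1 :> nat.
Proof.
case: i => -[//|i] ltie _ /=.
by rewrite modnDr modn_small // ltnW.
Qed.

(** Replacing [T i] by [T (i + e)] turns the cyclic predecessor into an ordinary one, including the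
    wrap-around at [0]. *)
Lemma dual_ord_pred (G : groupType) (T : nat -> G) (D : G) (e : nat) (i : 'I_e) :
  (forall n, T n.+1 * T n = D) -> T e = T 0%N -> T i * T (ord_pred i) = D.
Proof.
move=> TT Te; rewrite /= (dual_modn TT Te) -(dual_periodic TT Te).
by case: e i Te => [[]|e i _] //=; rewrite addnS TT.
Qed.

Lemma prod_alt_word (X : Type) (G : groupType) (f : X -> G) (a b : X) (n : nat) :
  \prod_(x <- alt_word a b n) f x = alt_prod (f a) (f b) n.
Proof.
elim: n a b => [|n IH] a b; first by rewrite /alt_prod /= !big_nil.
by rewrite alt_prodS /= big_cons IH.
Qed.

Definition prod_seqE := (big_cons, big_nil, @mulg1, @mulgA).

Section BraidPresentation.
Variables (e r : nat).
Hypothesis (he : 0 < e).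

Let s (j : sidx r) : braid_group e r := braid_gen e (bmr_s j).
Variable T : nat -> braid_group e r.
Hypotheses (T0 : T 0%N = braid_gen e bmr_t0) (T1 : T 1%N = braid_gen e bmr_t1).
Hypothesis TSS : forall n, T n.+2 = T n.+1 * T n * (T n.+1)^-1.

Let D := T 1%N * T 0%N.

Lemma braid_TT n : T n.+1 * T n = D.
Proof. by elim: n => [//|n <-]; rewrite TSS mulgVK. Qed.

Let bmr_sat := @presented_satisfies _ (@bmr_rel e r).

Lemma braid_Te : T e = T 0%N.
Proof.
apply/(alt_prod_eq braid_TT he); rewrite T0 T1 -!prod_alt_word.
by apply: bmr_sat; constructor.
Qed.

Definition oplus_to_braid (x : oplus_gen e r) : braid_group e r :=
  match x with oplus_t i => T i | oplus_s j => s j end.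

Lemma oplus_to_braid_sat : satisfies oplus_to_braid (@oplus_rel e r).
Proof.
(* The boolean is coerced to [0] or [1], so [T b] runs through the two generators [t_0] and
   [t_1]. *)
have sat_st (j : sidx r) (b : bool) :
    val j = 3%N -> s j * T b * s j = T b * s j * T b.
  move=> j3; have := bmr_sat (bmr_st3 e b j3).
  by rewrite !prod_seqE; case: b; rewrite /= ?T0 ?T1.
move=> u v [i j ij|i j ij|j i j3|j i j4|i j].
- by have := bmr_sat (bmr_R1 e ij); rewrite !prod_seqE.
- by have := bmr_sat (bmr_R2 e ij); rewrite !prod_seqE.
- rewrite !prod_seqE /=; apply: (dual_braid braid_TT).
  + exact: (sat_st j false).
  + exact: (sat_st j true).
  + have := bmr_sat (bmr_stt e j3); rewrite !prod_seqE => H.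
    by rewrite /D T0 T1.
- rewrite !prod_seqE /=; apply: (dual_commute braid_TT).
  + have := bmr_sat (bmr_st4 e false j4); by rewrite /commute T0 !prod_seqE.
  + have := bmr_sat (bmr_st4 e true j4); by rewrite /commute T1 !prod_seqE.
- rewrite !prod_seqE /=.
  by rewrite !(dual_ord_pred _ braid_TT braid_Te).
Qed.

Let ops := presented (@oplus_rel e r).
(** Reducing indices modulo [e] makes the cyclic family a sequence over [nat], to which the section
    on constant products applies; for [e = 1] all its terms coincide. *)
Let tt (n : nat) : ops :=
  presented_gen (@oplus_rel e r) (oplus_t r (Ordinal (ltn_pmod n he))).
Let ss (j : sidx r) : ops := presented_gen (@oplus_rel e r) (oplus_s e j).

Let oplus_sat := @presented_satisfies _ (@oplus_rel e r).

Lemma oplus_tt n : tt n.+1 * tt n = tt 1%N * tt 0%N.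
Proof.
have := oplus_sat
  (oplus_R5 r (Ordinal (ltn_pmod n.+1 he)) (Ordinal (ltn_pmod 1 he))).
by rewrite -!ordS_modn !ordSK !prod_seqE !ordS_modn.
Qed.

Lemma oplus_te : tt e = tt 0%N.
Proof.
congr presented_gen; congr oplus_t.
by apply: val_inj; rewrite /= modnn mod0n.
Qed.

Definition braid_to_oplus (x : bmr_gen r) : ops :=
  match x with
  | bmr_t0 => tt 0%N
  | bmr_t1 => tt 1%N
  | bmr_s j => ss j
  end.

Lemma braid_to_oplus_sat : satisfies braid_to_oplus (@bmr_rel e r).
Proof.
have bt (b : bool) : braid_to_oplus (bmr_t r b) = tt b by case: b.
have st3 (j : sidx r) n : val j = 3%N -> ss j * tt n * ss j = tt n * ss j * tt n.
  move=> j3; have := oplus_sat (oplus_R3 (Ordinal (ltn_pmod n he)) j3).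
  by rewrite !prod_seqE.
move=> u v [i j ij|i j ij||j i j3|j i j4|j j3].
- by have := oplus_sat (oplus_R1 e ij); rewrite !prod_seqE.
- by have := oplus_sat (oplus_R2 e ij); rewrite !prod_seqE.
- rewrite !prod_alt_word; apply/(alt_prod_eq oplus_tt he); exact: oplus_te.
- by rewrite !prod_seqE bt; apply: st3.
- have := oplus_sat (oplus_R4 (Ordinal (ltn_pmod i he)) j4).
  by rewrite !prod_seqE bt.
- rewrite !prod_seqE /=.
  have := (braid_dual_step (st3 j 1%N j3) (st3 j 0%N j3)).2; rewrite !mulgA; apply.
  (* The conjugate occurring in [braid_dual_step] is [tt 2], whose braid relation with [ss j] is
     again an instance of [oplus_R3]. *)
  have tt2 : tt 2 = tt 1 * tt 0 * (tt 1)^-1 by rewrite -(oplus_tt 1) mulgK.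
  by have := st3 j 2%N j3; rewrite tt2 !mulgA.
Qed.

(** Both sequences obey the recursion of [dualS], with corresponding initial terms and constants. *)
Lemma braid_oplus_t n : presented_lift braid_to_oplus (T n) = tt n.
Proof.
have gM := presented_liftM braid_to_oplus_sat.
have g_t0 : presented_lift braid_to_oplus (T 0%N) = tt 0%N.
  by rewrite T0 (presented_lift_gen braid_to_oplus_sat).
elim: n => // n IH; rewrite (dualS braid_TT) gM.
rewrite (presented_liftV braid_to_oplus_sat) IH /D gM g_t0 T1.
rewrite (presented_lift_gen braid_to_oplus_sat).
by rewrite (dualS oplus_tt).
Qed.

Lemma oplus_presents_braid : is_presentation (@oplus_rel e r) oplus_to_braid.
Proof.
apply: (presentation_of_inverse (g := braid_to_oplus)).
- exact: oplus_to_braid_sat.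
- exact: braid_to_oplus_sat.
- case=> [i|j] /=; last exact: (presented_lift_gen braid_to_oplus_sat).
  rewrite braid_oplus_t; congr presented_gen; congr oplus_t.
  by apply: val_inj; rewrite /= modn_small.
- case=> [||j]; rewrite (presented_lift_gen oplus_to_braid_sat) //=.
  + by rewrite mod0n.
  (* For [e = 1] the index [1 %% e] is [0], hence the appeal to periodicity. *)
  + by rewrite (dual_modn braid_TT braid_Te).
Qed.

End BraidPresentation.

Lemma braid_presentation (e r : nat) (he : 1 <= e) :
  exists f : oplus_gen e r -> braid_group e r,
     [/\ (forall i : 'I_e, i = 0 %[mod e] -> f (oplus_t r i) = braid_gen e bmr_t0),
         (forall i : 'I_e, i = 1 %[mod e] -> f (oplus_t r i) = braid_gen e bmr_t1),
         (forall j : sidx r, f (oplus_s e j) = braid_gen e (bmr_s j)),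
         (forall i : 'I_e, 2 <= i ->
            f (oplus_t r i) =
            f (oplus_t r (ord_pred i)) *
             f (oplus_t r (ord_pred (ord_pred i))) *
             (f (oplus_t r (ord_pred i)))^-1) &
         is_presentation (@oplus_rel e r) f].
Proof.
have [T [T0 T1 TSS]] :=
  dual_sequence_exists (braid_gen e (@bmr_t0 r)) (braid_gen e (@bmr_t1 r)).
have TT := braid_TT TSS.
have Te := braid_Te he T0 T1 TSS.
exists (oplus_to_braid T); split=> [i i0|i i1|//|i i2|] /=.
- by rewrite -T0 -(dual_modn TT Te) i0 mod0n.
- by rewrite -T1 -(dual_modn TT Te) i1 (dual_modn TT Te).
(* As [2 <= i], neither of the two predecessors wraps around. *)
- have Ei := val_ord_pred (ltnW i2).
  have Eii : ord_pred (ord_pred i) = i.-2 :> nat.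
    by rewrite val_ord_pred Ei //; lia.
  move: Ei Eii => /= -> ->.
  by case: (i : nat) i2 => [|[|n]] // _; rewrite TSS.
- exact: oplus_presents_braid.
Qed.

(** * Coset representatives modulo squares *)

(* Coordinates are numbered from 0: [s n] stands for the generator [s_(n+2)] of
   the paper and exchanges coordinates [n] and [n+1], while the [t_a] are the
   elements [D ^+ a * tau] and exchange coordinates 0 and 1 up to scalars. *)
Section Frames.
Variables (Q : groupType) (D tau : Q) (s : nat -> Q) (e r : nat).
Hypothesis e_gt0 : 0 < e.
Hypothesis De : D ^+ e = 1.
Hypothesis tau2 : tau * tau = 1.
Hypothesis tauD : tau * D = D^-1 * tau.
Hypothesis s2 : forall n, 0 < n -> n.+1 < r -> s n * s n = 1.
Hypothesis s_braid : forall n, 0 < n -> n.+2 < r ->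
  s n * s n.+1 * s n = s n.+1 * s n * s n.+1.
Hypothesis s_comm : forall i j, 0 < i -> i.+1 < j -> j.+1 < r ->
  commute (s i) (s j).
Hypothesis s1_braid : 2 < r -> forall a,
  s 1 * (D ^+ a * tau) * s 1 = (D ^+ a * tau) * s 1 * (D ^+ a * tau).
Hypothesis s_commD : forall n, 1 < n -> n.+1 < r -> commute (s n) D.
Hypothesis s_comm_tau : forall n, 1 < n -> n.+1 < r -> commute (s n) tau.

Definition dpow (d : Q) : Prop := exists a, d = D ^+ a.

Lemma dpow1 : dpow 1. Proof. by exists 0%N. Qed.

Lemma dpowM d d' : dpow d -> dpow d' -> dpow (d * d').
Proof. by move=> [a ->] [b ->]; exists (a + b)%N; rewrite expgnDr. Qed.

(** As [D ^+ e = 1], the inverse of [D] is [D ^+ e.-1]: natural exponents already describe the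
    cyclic group generated by [D]. *)
Lemma dpowV d : dpow d -> dpow d^-1.
Proof.
move=> [a ->]; exists (e.-1 * a)%N; rewrite expgnA -expVgn; congr (_ ^+ _).
by apply: mulg1_eq; rewrite -expgS prednK.
Qed.

Lemma dpow_commute d d' : dpow d -> dpow d' -> d * d' = d' * d.
Proof. by move=> [a ->] [b ->]; rewrite -!expgnDr addnC. Qed.

(** The involution [tau] inverts [D], so the [D ^+ a * tau] multiply like the reflections of a
    dihedral group. *)
Lemma tau_dpow d : dpow d -> tau * d = d^-1 * tau.
Proof.
move=> [a ->] {d}; elim: a => [|a IH]; first by rewrite invg1 mulg1 mul1g.
by rewrite expgS mulgA tauD -mulgA IH mulgA -invgM -expgSr expgS.
Qed.

Lemma s_comm_dpow n d : 1 < n -> n.+1 < r -> dpow d -> s n * d = d * s n.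
Proof. by move=> n1 nr [a ->]; apply: commuteX; apply: s_commD. Qed.

Lemma s1_braid_dpow d : 2 < r -> dpow d ->
  s 1 * (d * tau) * s 1 = d * tau * s 1 * (d * tau).
Proof. by move=> r2 [a ->]; apply: s1_braid. Qed.

Lemma dtau2 d : dpow d -> d * tau * (d * tau) = 1.
Proof.
by move=> dD; rewrite mulgA -(mulgA d) tau_dpow // mulVKg tau2.
Qed.

Definition descent (n : nat) : Q := \prod_(i <- rev (iota 1 n.-1)) s i.

Lemma descent0 : descent 0 = 1. Proof. by rewrite /descent big_nil. Qed.

Lemma descent1 : descent 1 = 1. Proof. by rewrite /descent big_nil. Qed.

Lemma descentS n : 0 < n -> descent n.+1 = s n * descent n.
Proof.
case: n => // n _.
have nE : n.+2.-1 = (n + 1)%N by rewrite addn1.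
by rewrite /descent nE iotaD cats1 rev_rcons big_cons add1n.
Qed.

Lemma descent_comm m n : m < n -> n.+1 < r -> s n * descent m = descent m * s n.
Proof.
elim: m => [|[|m] IH] mn nr; rewrite ?descent0 ?descent1 ?mulg1 ?mul1g // descentS //.
by rewrite mulgA -s_comm // -!mulgA IH // ltnW.
Qed.

(** Moving left, [s j.+1] commutes with the factors of index below [j], the braid relation turns it
    into [s j], and [s j] commutes with the factors of index above [j.+1]. *)
Lemma descent_shift m j : 0 < j -> j.+1 < m -> m < r ->
  descent m * s j.+1 = s j * descent m.
Proof.
elim: m => // m IH j0 jm mr; rewrite descentS; last by lia.
have [jm'|mj] := ltnP j.+1 m.
  rewrite -mulgA IH //; last by lia.
  by rewrite mulgA -s_comm ?mulgA //; lia.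
have {jm mj} mE : m = j.+1 by lia.
by subst m; rewrite descentS // -!mulgA -descent_comm // !mulgA -s_braid //; lia.
Qed.

(** The element [s 1 * (d * tau) * s 1] exchanges coordinates 0 and 2 up to scalars and so fixes
    coordinate 1; conjugation by [descent m] brings it back to a generator. The factors of index
    above 1 commute with [d * tau], which leaves [m = 2], where two copies of [s 1] cancel. *)
Lemma descent_conj_t m d : 1 < m -> m < r -> dpow d ->
  descent m * (s 1 * (d * tau) * s 1) = d * tau * descent m.
Proof.
move=> m1 mr dD; elim: m m1 mr => // -[//|[_ _ r2|m IH _ mr]].
  by rewrite descentS // descent1 !mulg1 !mulgA s2 // mul1g.
rewrite descentS // -mulgA IH ?(ltnW mr) // !(mulgA (s _)) (s_comm_dpow _ _ dD) //.
by rewrite -(mulgA d) s_comm_tau // !mulgA.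
Qed.

(** The generators moving only the first [k] coordinates are involutions for [k <= r], so their
    products form a subgroup. *)
Inductive parabolic (k : nat) : Q -> Prop :=
| parabolic1 : parabolic k 1
| parabolic_t d g : 1 < k -> dpow d -> parabolic k g -> parabolic k (d * tau * g)
| parabolic_s n g : 0 < n -> n.+1 < k -> parabolic k g -> parabolic k (s n * g).

Lemma parabolicM k g h : parabolic k g -> parabolic k h -> parabolic k (g * h).
Proof.
move=> Pg Ph; elim: Pg => [|d x k1 dD _ IH|n x n0 nk _ IH]; rewrite ?mul1g //.
- by rewrite -mulgA; apply: parabolic_t.
- by rewrite -mulgA; apply: parabolic_s.
Qed.

(* In the action on coordinate vectors, [frame i d] sends [E 1] to a multiple of
   [E i] and [descent m] sends [E 1] to [E m], so the [frame i d * (descent m)^-1]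
   are coset representatives of the stabilizer [parabolic m] of [E m] in
   [parabolic m.+1]. *)
Definition frame (i : nat) (d : Q) : Q := if i is 0 then d * tau else descent i * d.

(** The residue [h] belongs to the stabilizer of [E 1], and conjugation by [descent m] carries it
    into the stabilizer of [E m]. Multiplying on the right by [(descent m)^-1] thus turns [x] into a
    coset representative times an element of [parabolic m]. *)
Definition frame_step (m : nat) (x : Q) : Prop :=
  exists i d h, [/\ i <= m, dpow d,
                    parabolic m (descent m * h * (descent m)^-1) &
                    x = frame i d * h].

Lemma frame_step1 m i d : i <= m -> dpow d -> frame_step m (frame i d).
Proof.
move=> im dD; exists i, d, 1; split; rewrite ?mulg1 ?mulgV //.
exact: parabolic1.
Qed.

Lemma parabolic_conj_t m d : 1 < m -> m < r -> dpow d ->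
  parabolic m (descent m * (s 1 * (d * tau) * s 1) * (descent m)^-1).
Proof.
move=> m1 mr dD; rewrite descent_conj_t // mulgK -[_ * tau]mulg1.
by apply: parabolic_t => //; apply: parabolic1.
Qed.

Lemma parabolic_conj_s m j : 1 < j -> j < m -> m < r ->
  parabolic m (descent m * s j * (descent m)^-1).
Proof.
case: j => [|[|j]] // _ jm mr; rewrite descent_shift // mulgK -[s _]mulg1.
by apply: parabolic_s => //; apply: parabolic1.
Qed.

(** A generator [b * tau] interchanges the representatives for [i = 0] and [i = 1], and keeps every
    other one up to a residue. *)
Lemma frame_step_t m i b d : 0 < m -> m < r -> i <= m -> dpow b -> dpow d ->
  frame_step m (b * tau * frame i d).
Proof.
move=> m0 mr im bD dD; have dVD := dpowV dD.
have E0 : b * tau * d = b * d^-1 * tau by rewrite -!mulgA tau_dpow.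
case: i im => [|[|i]] im.
- rewrite /= mulgA E0 -mulgA tau2 mulg1.
  have -> : b * d^-1 = frame 1 (b * d^-1) by rewrite /= descent1 mul1g.
  exact/frame_step1/dpowM.
- rewrite /= descent1 mul1g E0.
  have -> : b * d^-1 * tau = frame 0 (b * d^-1) by [].
  exact/frame_step1/dpowM.
(* The residue is [b * tau] conjugated by [frame i.+2 d]. The factors of [descent] above [s 1]
   commute with [b * tau], so everything reduces to [descent 2], where two braid relations
   suffice. *)
- exists i.+2, d, (s 1 * (b * d^-1 * tau) * s 1); split=> //.
    by apply: parabolic_conj_t; [exact: leq_trans im | | exact: dpowM].
  have r2 : 2 < r by apply: leq_ltn_trans mr; exact: leq_trans im.
  elim: i im => [im|i IH im].
    have dt : d * (b * d^-1 * tau) = b * tau.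
      by rewrite [b * _]dpow_commute // !mulgA mulgV mul1g.
    have tt : b * tau * (b * d^-1 * tau) = d.
      rewrite mulgA -(mulgA b) tau_dpow; last exact: dpowM.
      by rewrite invgM invgK !mulgA -mulgA tau2 mulg1 (dpow_commute bD dD) mulgK.
    rewrite /= (descentS (n := 1)) // descent1 mulg1 s1_braid_dpow //;
      last exact: dpowM.
    rewrite -[RHS]mulgA -(mulgA _ (s 1)) (mulgA d) dt (mulgA (s 1)) (mulgA (s 1 * _)).
    by rewrite s1_braid_dpow // -[RHS]mulgA tt mulgA.
  have ir : i.+3 < r by apply: leq_ltn_trans mr.
  have -> : frame i.+3 d = s i.+2 * frame i.+2 d by rewrite /frame descentS // mulgA.
  rewrite (mulgA (b * tau)) -(mulgA b tau) -s_comm_tau // (mulgA b (s _)).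
  rewrite -(s_comm_dpow _ _ bD) //.
  by rewrite -!(mulgA (s i.+2)) IH // ltnW.
Qed.

(** For positive [i], the factor [s n] cancels the leading factor of [descent i] if [n = i.-1],
    lengthens it if [n = i], commutes with it if [n > i], and passes through it as [s n.+1] if
    [n < i.-1]. For [i = 0] it commutes with the representative, unless [n = 1], where the braid
    relation gives the residue. *)
Lemma frame_step_s m i n d : 0 < m -> m < r -> i <= m -> dpow d ->
  0 < n -> n < m -> frame_step m (s n * frame i d).
Proof.
move=> m0 mr im dD n0 nm; have nr : n.+1 < r by lia.
case: i im => [|i] im.
  have [n1|n1] := ltnP 1 n.
    exists 0%N, d, (s n); split=> //; first exact: parabolic_conj_s.
    by rewrite /= mulgA s_comm_dpow // -!mulgA s_comm_tau.
  have -> : n = 1%N by lia.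
  exists 0%N, d, (s 1 * (d * tau) * s 1); split=> //.
    by apply: parabolic_conj_t => //; lia.
  rewrite s1_braid_dpow //; last by lia.
  by rewrite /= 2!(mulgA (d * tau)) dtau2 // mul1g.
rewrite /frame mulgA; have [lti|lti|Ei] := ltngtP n i.+1.
- have [ni|ni] := ltnP n i.
    exists i.+1, d, (s n.+1); split=> //.
      by apply: parabolic_conj_s => //; lia.
    rewrite /= -(mulgA (descent _)) -s_comm_dpow //; last by lia.
    by rewrite mulgA descent_shift //; lia.
  have nE : n = i by lia.
  subst n; rewrite descentS // mulgA s2 // mul1g.
  (* Here [i] is positive, so [frame i d] is not the exceptional representative [d * tau]. *)
  have -> : descent i * d = frame i d by case: (i) n0.
  by apply: frame_step1 => //; lia.
- exists i.+1, d, (s n); split=> //; first by apply: parabolic_conj_s; lia.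
  by rewrite descent_comm // /= -!mulgA s_comm_dpow //; lia.
- subst n; rewrite -descentS //.
  have -> : descent i.+2 * d = frame i.+2 d by [].
  exact: frame_step1.
Qed.

(** The elements of the required form contain 1, since [frame m 1 = descent m], and the two
    [frame_step] lemmas make them stable under left multiplication by generators. *)
Lemma parabolic_decomposition m g : 0 < m -> m < r -> parabolic m.+1 g ->
  exists i d h, [/\ i <= m, dpow d, parabolic m h & g = frame i d * (descent m)^-1 * h].
Proof.
move=> m0 mr; elim=> {g} [|b g _ bD _ [i [d [h [im dD Ph ->]]]]|
  n g n0 nm _ [i [d [h [im dD Ph ->]]]]].
- exists m, 1, 1; split=> //; [exact: dpow1|exact: parabolic1|].
  by case: (m) m0 => // k _; rewrite /= !mulg1 mulgV.
- have [i' [d' [h' [im' dD' Ph' E]]]] := frame_step_t m0 mr im bD dD.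
  exists i', d', (descent m * h' * (descent m)^-1 * h).
  split=> //; first exact: parabolicM.
  by rewrite !mulgA mulgVK E.
- have [i' [d' [h' [im' dD' Ph' E]]]] := frame_step_s m0 mr im dD n0 nm.
  exists i', d', (descent m * h' * (descent m)^-1 * h).
  split=> //; first exact: parabolicM.
  by rewrite !mulgA mulgVK E.
Qed.

Lemma parabolic_triv g : parabolic 1 g -> g = 1.
Proof. by case. Qed.

(** * Faithfulness and transitivity through an action on coordinate vectors *)

Section Action.
Variables (C : fieldType) (V : lmodType C) (act : Q -> V -> V) (E : nat -> V).
Variable z : C.
Hypothesis z_prim : (e.-primitive_root z)%R.
Hypothesis actM : forall g h v, act (g * h) v = act g (act h v).
Hypothesis act1 : forall v, act 1 v = v.
Hypothesis actZ : forall g c v, act g (c *: v)%R = (c *: act g v)%R.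
Hypothesis E_free : forall i j c,
  i < r -> j < r -> E i = (c *: E j)%R -> i = j /\ c = 1%R.
Hypothesis actD0 : act D (E 0) = (z^-1 *: E 0)%R.
Hypothesis actD1 : act D (E 1) = (z *: E 1)%R.
Hypothesis actD : forall n, 1 < n -> n < r -> act D (E n) = E n.
Hypothesis act_tau1 : act tau (E 1) = E 0.
Hypothesis act_tau : forall n, 1 < n -> n < r -> act tau (E n) = E n.
Hypothesis act_s0 : forall n, 0 < n -> n.+1 < r -> act (s n) (E n) = E n.+1.
Hypothesis act_s : forall n, 0 < n -> n.+1 < r ->
  forall j, j < r -> j != n -> j != n.+1 -> act (s n) (E j) = E j.

Lemma act_dpow j d : 1 < j -> j < r -> dpow d -> act d (E j) = E j.
Proof.
move=> j1 jr [a ->]; elim: a => [|a IH]; first by rewrite act1.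
by rewrite expgS actM IH actD.
Qed.

Lemma act_dpow0 a : act (D ^+ a) (E 0) = (z ^- a *: E 0)%R.
Proof.
elim: a => [|a IH]; first by rewrite act1 GRing.expr0 invr1 scale1r.
by rewrite expgS actM IH actZ actD0 scalerA -exprVn -exprSr exprVn.
Qed.

Lemma act_dpow1 a : act (D ^+ a) (E 1) = (z ^+ a *: E 1)%R.
Proof.
elim: a => [|a IH]; first by rewrite act1 GRing.expr0 scale1r.
by rewrite expgS actM IH actZ actD1 scalerA -exprSr.
Qed.

Lemma act_descent m : 0 < m -> m < r -> act (descent m) (E 1) = E m.
Proof.
elim: m => [//|[|m] IH] _ mr; first by rewrite descent1 act1.
by rewrite descentS // actM IH ?(ltnW mr) // act_s0.
Qed.

Lemma actV_eq g i j : act g (E i) = E j -> act g^-1 (E j) = E i.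
Proof. by move=> <-; rewrite -actM mulVg act1. Qed.

Lemma act_frame i a : i < r ->
  act (frame i (D ^+ a)) (E 1) = ((if i == 0 then z ^- a else z ^+ a) *: E i)%R.
Proof.
case: i => [|i] ir /=; rewrite actM; first by rewrite act_tau1 act_dpow0.
by rewrite act_dpow1 actZ act_descent.
Qed.

Lemma parabolic_fix k g j : parabolic k g -> k <= j -> j < r -> act g (E j) = E j.
Proof.
move=> Pg kj jr; elim: Pg => [|d h k1 dD _ IH|n h n0 nk _ IH]; first exact: act1.
- by rewrite !actM IH act_tau ?act_dpow //; lia.
- by rewrite actM IH act_s //; lia.
Qed.

(** In the decomposition of [g], the factor [h] fixes the last vector, so the representative must
    fix it too. This forces its index to be the last one and its scalar [z ^+ a] to be 1; then [e]
    divides [a] by primitivity, the representative is trivial, and [g = h] lies in the smaller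
    subgroup. *)
Lemma parabolic_faithful k g : 0 < k -> k <= r -> parabolic k g ->
  (forall j, j < r -> act g (E j) = E j) -> g = 1.
Proof.
case: k => // k _ kr; elim: k kr g => [|k IH] kr g Pg gE.
  exact: parabolic_triv.
have [i [d [h [ik [a dE] Ph gfh]]]] := parabolic_decomposition (ltn0Sn k) kr Pg.
suff gh : g = h by rewrite gh; apply: IH (ltnW kr) _ Ph _; rewrite -gh.
have := gE k.+1 kr; rewrite {1}gfh !actM (parabolic_fix Ph) //.
rewrite (actV_eq (act_descent (ltn0Sn k) kr)) dE.
rewrite act_frame ?(leq_ltn_trans ik kr) //.
move=> /esym /(E_free kr (leq_ltn_trans ik kr)) [].
case: i ik gfh => // i ik gfh ik1 /= za.
have d1 : d = 1.
  have := prim_order_dvd z_prim a; rewrite za eqxx => /dvdnP[q aE].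
  by rewrite dE aE mulnC expgnA De expg1n.
by rewrite gfh ik1 d1 /frame mulg1 mulgV mul1g.
Qed.

Lemma frame_surjective m i c : 0 < m -> m < r -> i <= m -> (c ^+ e = 1)%R ->
  exists g, act g (E m) = (c *: E i)%R /\
    (forall j, m < j -> j < r -> act g (E j) = E j).
Proof.
move=> m0 mr im ce.
have [a ac] : exists a, act (frame i (D ^+ a)) (E 1) = (c *: E i)%R.
  have ce' : (c^-1 ^+ e = 1)%R by rewrite exprVn ce invr1.
  (* On coordinate 0, [D] acts by the inverse of [z], so there the exponent is that of [c^-1]. *)
  case: eqP (fun a => @act_frame i a (leq_ltn_trans im mr)) => [_|_] H.
    have [a aE] := prim_rootP z_prim ce'.
    by exists a; rewrite H -aE invrK.
  by have [a aE] := prim_rootP z_prim ce; exists a; rewrite H -aE.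
exists (frame i (D ^+ a) * (descent m)^-1); split.
  by rewrite actM (actV_eq (act_descent m0 mr)).
have descent_fix k j : k <= m -> m < j -> j < r -> act (descent k) (E j) = E j.
  move=> km mj jr; elim: k km => [|[|k] IH] km; rewrite ?descent0 ?descent1 ?act1 //.
  by rewrite descentS // actM IH ?act_s //; lia.
have aD : dpow (D ^+ a) by exists a.
move=> j mj jr; rewrite actM (actV_eq (descent_fix _ _ (leqnn m) mj jr)).
case: i im {ac} => [|i] im /=; rewrite actM.
  by rewrite act_tau ?act_dpow //; lia.
by rewrite act_dpow ?descent_fix //; lia.
Qed.

End Action.

End Frames.

(** * Reflections in the monomial group *)

Section Reflections.
Variables (C : fieldType) (e r : nat).
Local Open Scope ring_scope.
Implicit Types (x y w j : 'I_r) (a b c : C) (g h : Geer C e r).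

Definition basis_vec j : 'cV[C]_r := delta_mx j 0.

Definition Geer_act g (v : 'cV[C]_r) : 'cV[C]_r := Geer_mx g *m v.

Lemma Geer_actM g h v : Geer_act (g * h)%g v = Geer_act g (Geer_act h v).
Proof. by rewrite /Geer_act mulmxA. Qed.

Lemma Geer_act1 v : Geer_act 1%g v = v.
Proof. exact: mul1mx. Qed.

Lemma Geer_actZ g c v : Geer_act g (c *: v) = c *: Geer_act g v.
Proof. by rewrite /Geer_act scalemxAr. Qed.

Lemma Geer_act_inj g h :
  (forall j, Geer_act g (basis_vec j) = Geer_act h (basis_vec j)) -> g = h.
Proof.
move=> gh; apply: val_inj; apply/matrixP => i j.
have := gh j; rewrite /Geer_act /basis_vec -!colE => /matrixP /(_ i 0).
by rewrite !mxE.
Qed.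

(** Row [i] of [mono_mx s d] has its entry in column [s i], so column vectors are moved by the
    inverse permutation. *)
Lemma mono_mx_basis (s : 'S_r) (d : 'I_r -> C) (j : 'I_r) :
  mono_mx s d *m basis_vec j = d ((s^-1)%g j) *: basis_vec ((s^-1)%g j).
Proof.
apply/matrixP => i k; rewrite -colE !mxE ord1 eqxx andbT.
rewrite -(can2_eq (permK s) (permKV s)) eq_sym.
by case: eqP => [<-|_]; rewrite ?permK ?mulr1 ?mulr0.
Qed.

Lemma basis_vec_free i j c : basis_vec i = c *: basis_vec j -> i = j /\ c = 1.
Proof.
move=> /matrixP /(_ i 0); rewrite !mxE !eqxx /= andbT.
case: eqP => [-> | _]; rewrite ?mulr1 ?mulr0 => /eqP; last by rewrite oner_eq0.
by rewrite eq_sym => /eqP.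
Qed.

Lemma Geer_act_monomial g : exists (s : 'S_r) (c : 'I_r -> C),
  [/\ forall j, Geer_act g (basis_vec j) = c j *: basis_vec (s j),
      forall j, c j ^+ e = 1 & \prod_j c j = 1].
Proof.
have [s [d [gE _ de dp]]] := in_GeerP _ _ (GeerP g).
exists (s^-1)%g, (fun j => d ((s^-1)%g j)); split=> // [j|].
  by rewrite /Geer_act gE mono_mx_basis.
by rewrite -[RHS]dp [RHS](reindex_inj (@perm_inj _ s^-1%g)).
Qed.

(** The permutation must fix the remaining index, and the scalars having product 1 forces the
    remaining scalar to be 1. This is the base case of surjectivity. *)
Lemma Geer_fix_but_one j0 g :
  (forall j, j != j0 -> Geer_act g (basis_vec j) = basis_vec j) -> g = 1%g.
Proof.
move=> gfix; have [s [c [gE _ cp]]] := Geer_act_monomial g.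
have sc j : j != j0 -> s j = j /\ c j = 1.
  move=> /gfix; rewrite gE.
  by move=> /esym/basis_vec_free[].
have sj0 : s j0 = j0.
  have [//|sj] := eqVneq (s j0) j0.
  by have [/perm_inj] := sc _ sj.
have cj0 : c j0 = 1.
  by move: cp; rewrite (bigD1 j0) //= big1 ?mulr1 // => j /sc[].
apply: Geer_act_inj => j; rewrite Geer_act1 gE.
by have [->|/sc[-> ->]] := eqVneq j j0; rewrite ?sj0 ?cj0 scale1r.
Qed.

Definition refl_mx x y c : 'M[C]_r :=
  mono_mx (tperm x y) (fun i => if i == x then c^-1 else if i == y then c else 1).

(** Outside the group [insubd] falls back to 1; [val_refl] excludes this for distinct coordinates
    and a nonzero [c] with [c ^+ e = 1]. *)
Definition refl x y c : Geer C e r := insubd (1%g : Geer C e r) (refl_mx x y c).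

Section TwoCoordinates.
Variables (x y : 'I_r) (c : C).
Hypotheses (xy : x != y) (ce : c ^+ e = 1) (c0 : c != 0).

Lemma val_refl : Geer_mx (refl x y c) = refl_mx x y c.
Proof.
rewrite /refl [LHS]val_insubd ifT //; apply/in_GeerP.
exists (tperm x y), (fun i => if i == x then c^-1 else if i == y then c else 1).
split=> // [i|i|].
- by case: ifP; [rewrite invr_eq0 | case: ifP => //; rewrite oner_neq0].
- by case: ifP; [rewrite exprVn ce invr1 | case: ifP => //; rewrite expr1n].
- have yx : y != x by rewrite eq_sym.
  rewrite (bigD1 x) //= eqxx (bigD1 y) //= (negbTE yx) eqxx.
  rewrite big1 ?mulr1 ?mulVf // => i /andP[ix iy].
  by rewrite (negbTE ix) (negbTE iy).
Qed.

Lemma refl_left : Geer_act (refl x y c) (basis_vec x) = c *: basis_vec y.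
Proof.
rewrite /Geer_act val_refl mono_mx_basis tpermV tpermL eq_sym (negbTE xy).
by rewrite eqxx.
Qed.

Lemma refl_right : Geer_act (refl x y c) (basis_vec y) = c^-1 *: basis_vec x.
Proof. by rewrite /Geer_act val_refl mono_mx_basis tpermV tpermR eqxx. Qed.

Lemma refl_other j : j != x -> j != y ->
  Geer_act (refl x y c) (basis_vec j) = basis_vec j.
Proof.
move=> jx jy; rewrite /Geer_act val_refl mono_mx_basis tpermV.
have -> : tperm x y j = j by rewrite tpermD // eq_sym.
by rewrite (negbTE jx) (negbTE jy) scale1r.
Qed.

Lemma refl_square : (refl x y c * refl x y c)%g = 1%g.
Proof.
apply: Geer_act_inj => j; rewrite Geer_actM Geer_act1.
have [->|jx] := eqVneq j x.
  by rewrite refl_left Geer_actZ refl_right scalerA mulfV // scale1r.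
have [->|jy] := eqVneq j y.
  by rewrite refl_right Geer_actZ refl_left scalerA mulVf // scale1r.
by rewrite !refl_other.
Qed.

Lemma refl_neq1 : refl x y c <> 1%g.
Proof.
move=> E; have := refl_left; rewrite E Geer_act1 => /basis_vec_free[/eqP].
by rewrite (negbTE xy).
Qed.

(** The fixed hyperplane is the kernel of the functional [phi], whose image is a nonzero subspace of
    a line because [phi] is [-1] on [basis_vec y]. *)
Lemma refl_is_reflection : is_reflection (refl x y c).
Proof.
split; first exact: refl_neq1.
pose phi (u : 'cV[C]_r) : C^o := c * u x 0 - u y 0.
have phi_lin : linear phi.
  by move=> k u u'; rewrite /phi !mxE /GRing.scale /=; ring.
pose phiL := GRing.isLinear.Build _ _ _ _ phi phi_lin.
pose phil : {linear 'cV[C]_r -> C^o} := HB.pack phi phiL.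
exists (lker (linfun phil)); split.
  have dimV : \dim {: 'cV[C]_r} = r by rewrite dimvf /dim /= muln1.
  rewrite -[RHS]dimV -(limg_ker_dim (linfun phil) fullv) capfv.
  rewrite -[LHS]addn1; congr addn.
  apply/esym/eqP; rewrite eqn_leq; apply/andP; split.
    by apply: leq_trans (dimvS (subvf _)) _; rewrite dimvf.
  rewrite lt0n dimv_eq0; apply/eqP => img0.
  have : linfun phil (basis_vec y) \in (linfun phil @: fullv)%VS.
    exact/memv_img/memvf.
  rewrite img0 memv0 lfunE /= /phi !mxE eqxx (negbTE xy) mulr0 sub0r.
  by rewrite oppr_eq0 eqxx /= (oner_eq0 C).
move=> v; rewrite memv_ker lfunE /= subr_eq0 => /eqP vxy.
apply/matrixP => i k; rewrite val_refl ord1 !mxE.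
rewrite (bigD1 (tperm x y i)) //= mxE eqxx big1 ?addr0; last first.
  by move=> l /negbTE li; rewrite mxE li mul0r.
have [->|ix] := eqVneq i x; first by rewrite tpermL -vxy mulKf.
have [->|iy] := eqVneq i y; first by rewrite tpermR vxy.
by rewrite tpermD 1?[_ == i]eq_sym // mul1r.
Qed.

End TwoCoordinates.

Lemma refl_braid x y w a b : x != y -> y != w -> x != w ->
  a ^+ e = 1 -> b ^+ e = 1 -> a != 0 -> b != 0 ->
  (refl x y a * refl y w b * refl x y a)%g =
  (refl y w b * refl x y a * refl y w b)%g.
Proof.
move=> xy yw xw ae be a0 b0.
have [yx wy wx] : [/\ y != x, w != y & w != x] by split; rewrite eq_sym.
apply: Geer_act_inj => j; rewrite !Geer_actM.
have [->|jx] := eqVneq j x.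
  by rewrite !(refl_left, refl_other, Geer_actZ).
have [->|jy] := eqVneq j y.
  rewrite !(refl_left, refl_right, refl_other, Geer_actZ) // !scalerA.
  by rewrite mulVf ?mulfV.
have [->|jw] := eqVneq j w.
  by rewrite !(refl_right, refl_other, Geer_actZ).
by rewrite !refl_other.
Qed.

Lemma refl_comm x y (v : 'I_r) w a b : x != y -> v != w ->
  x != v -> x != w -> y != v -> y != w ->
  a ^+ e = 1 -> b ^+ e = 1 -> a != 0 -> b != 0 ->
  (refl x y a * refl v w b)%g = (refl v w b * refl x y a)%g.
Proof.
move=> xy vw xv xw yv yw ae be a0 b0.
have [vx wx vy wy] : [/\ v != x, w != x, v != y & w != y].
  by split; rewrite eq_sym.
apply: Geer_act_inj => j; rewrite !Geer_actM.
have [->|jx] := eqVneq j x; first by rewrite !(refl_left, refl_other, Geer_actZ).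
have [->|jy] := eqVneq j y; first by rewrite !(refl_right, refl_other, Geer_actZ).
have [->|jv] := eqVneq j v; first by rewrite !(refl_left, refl_other, Geer_actZ).
have [->|jw] := eqVneq j w; first by rewrite !(refl_right, refl_other, Geer_actZ).
by rewrite !refl_other.
Qed.

(** Either product is diagonal, scaling coordinate [x] by [z^-1] and coordinate [y] by [z]. *)
Lemma refl_dual x y z a b : x != y -> z ^+ e = 1 -> a ^+ e = 1 -> b ^+ e = 1 ->
  z != 0 -> a != 0 -> b != 0 ->
  (refl x y (z * a) * refl x y a)%g = (refl x y (z * b) * refl x y b)%g.
Proof.
move=> xy ze ae be z0 a0 b0.
have [zae zbe] : (z * a) ^+ e = 1 /\ (z * b) ^+ e = 1.
  by rewrite !exprMn ze ae be mulr1.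
have [za0 zb0] : z * a != 0 /\ z * b != 0 by rewrite !mulf_neq0.
apply: Geer_act_inj => j; rewrite !Geer_actM.
have [->|jx] := eqVneq j x.
  rewrite !(refl_left, refl_right, Geer_actZ) // !scalerA.
  by rewrite !invfM !(mulrCA _ z^-1) !mulfV.
have [->|jy] := eqVneq j y.
  rewrite !(refl_left, refl_right, Geer_actZ) // !scalerA.
  by rewrite !(mulrCA _ z) !mulVf.
by rewrite !refl_other.
Qed.

End Reflections.

(** * The presentation of the monomial group *)

Section ReflectionPresentation.
Variables (C : fieldType) (e r : nat) (z : C).
Hypotheses (e_gt0 : 0 < e) (r_gt0 : 0 < r) (z_prim : (e.-primitive_root z)%R).

Let ze : (z ^+ e = 1)%R := prim_expr_order z_prim.

Lemma root_neq0 (c : C) : (c ^+ e = 1)%R -> (c != 0)%R.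
Proof.
move=> ce; apply: contra_eq_neq ce => ->.
by rewrite expr0n gtn_eqF // eq_sym oner_eq0.
Qed.

Lemma rootX a : ((z ^+ a) ^+ e = 1)%R.
Proof. by rewrite exprAC ze expr1n. Qed.

Lemma expr_ord_pred (i : 'I_e) : (z ^+ i = z * z ^+ ord_pred i)%R.
Proof. by rewrite -exprS -(prim_expr_mod z_prim _.+1) -{1}(ord_predK i). Qed.

(** An out-of-range argument of [inord] gives coordinate 0, hence the bounds in [coord_eq]. *)
Let coord (n : nat) : 'I_r.+1 := inord n.

Lemma coord_eq i j : i <= r -> j <= r -> (coord i == coord j) = (i == j).
Proof. by move=> ir jr; rewrite -val_eqE /= !inordK. Qed.

Definition oplus_to_Geer (x : oplus_gen e r.+1) : Geer C e r.+1 :=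
  match x with
  | oplus_t i => refl e (coord 0) (coord 1) (z ^+ i)%R
  | oplus_s j => refl e (coord (val j - 2)) (coord (val j - 1)) 1%R
  end.

Let R := add_squares (@oplus_rel e r.+1).

Lemma oplus_to_Geer_refl (x : oplus_gen e r.+1) : exists i j c,
  [/\ oplus_to_Geer x = refl e i j c, i != j, (c ^+ e = 1)%R & (c != 0)%R].
Proof.
case: x => [i|[j jP]].
  exists (coord 0), (coord 1), (z ^+ i)%R.
  by rewrite coord_eq // root_neq0 ?rootX.
exists (coord (j - 2)), (coord (j - 1)), 1%R.
by rewrite coord_eq ?expr1n ?oner_neq0; [split=> //|..]; lia.
Qed.

Lemma oplus_to_Geer_sat : satisfies oplus_to_Geer R.
Proof.
have e1 : (1 ^+ e = 1 :> C)%R := expr1n C e.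
have n1 : (1 != 0 :> C)%R := oner_neq0 C.
have zn a : (z ^+ a != 0)%R := root_neq0 (rootX a).
have braidS n : n.+2 <= r -> forall a b : C, (a ^+ e = 1)%R -> (b ^+ e = 1)%R ->
    refl e (coord n) (coord n.+1) a * refl e (coord n.+1) (coord n.+2) b
      * refl e (coord n) (coord n.+1) a =
    refl e (coord n.+1) (coord n.+2) b * refl e (coord n) (coord n.+1) a
      * refl e (coord n.+1) (coord n.+2) b.
  move=> nr a b ae be.
  by apply: refl_braid; rewrite ?root_neq0 ?coord_eq //; lia.
have commS m n : m.+1 < n -> n.+1 <= r ->
    forall a b : C, (a ^+ e = 1)%R -> (b ^+ e = 1)%R ->
    refl e (coord m) (coord m.+1) a * refl e (coord n) (coord n.+1) b =
    refl e (coord n) (coord n.+1) b * refl e (coord m) (coord m.+1) a.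
  move=> mn nr a b ae be.
  by apply: refl_comm; rewrite ?root_neq0 ?coord_eq //; lia.
(* Writing [val j] as [n.+3] removes the truncated subtractions [val j - 2] and [val j - 1]. *)
have sE (j : sidx r.+1) : exists n, [/\ val j = n.+3, n.+2 <= r &
    oplus_to_Geer (oplus_s e j) = refl e (coord n.+1) (coord n.+2) 1%R].
  by case: j => [[|[|[|j]]] jP] //; exists j; split=> //.
move=> u v [[i j ij|i j ij|j i j3|j i j4|i j]|[x [-> ->]]];
  rewrite !prod_seqE.
- have [n [iE nr ->]] := sE i; have [m [jE mr ->]] := sE j.
  rewrite iE jE in ij.
  have [mE|nE] : m = n.+1 \/ n = m.+1 by lia.
    by subst m; apply: braidS.
  by subst n; apply/esym/braidS.
- have [n [iE nr ->]] := sE i; have [m [jE mr ->]] := sE j.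
  rewrite iE jE in ij.
  have [mn|nm] : n.+1 < m \/ m.+1 < n by lia.
    by apply: commS.
  by apply/esym/commS.
- have [n [jE nr ->]] := sE j; rewrite jE in j3.
  have nE : n = 0%N by lia.
  subst n.
  by apply/esym/braidS => //; apply: rootX.
- have [n [jE nr ->]] := sE j; rewrite jE in j4.
  by apply/esym/commS => //; apply: rootX.
- rewrite /= (expr_ord_pred i) (expr_ord_pred j).
  by apply: refl_dual; rewrite ?coord_eq ?rootX ?zn //; apply: root_neq0.
- have [i [j [c [-> ij ce c0]]]] := oplus_to_Geer_refl x.
  exact: refl_square.
Qed.

Let Q := presented R.
Let satQ := @presented_satisfies _ R.
Let satG := oplus_to_Geer_sat.
Let proj : Q -> Geer C e r.+1 := presented_lift oplus_to_Geer.

Let qt (i : 'I_e) : Q := presented_gen R (oplus_t r.+1 i).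
(** The shift by two passes from coordinate numbers to the names [s_3, s_4, ...]; out of range, 1 is
    a placeholder. *)
Let qs (n : nat) : Q :=
  if insub n.+2 is Some j then presented_gen R (oplus_s e j) else 1.
Let i0 := Ordinal e_gt0.
Let tau := qt i0.
Let D := qt i0 * qt (ord_pred i0).

Lemma Q_oplus u v : oplus_rel u v ->
  \prod_(x <- u) presented_gen R x = \prod_(x <- v) presented_gen R x.
Proof. by move=> uv; apply: satQ; left. Qed.

Lemma Q_square x : presented_gen R x * presented_gen R x = 1.
Proof.
have : R [:: x; x] [::] by right; exists x.
by move=> /satQ; rewrite !prod_seqE.
Qed.

Lemma qt2 i : qt i * qt i = 1. Proof. exact: Q_square. Qed.

Lemma qt_dual i : qt i * qt (ord_pred i) = D.
Proof. by have := Q_oplus (oplus_R5 r.+1 i i0); rewrite !prod_seqE. Qed.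

Lemma qt_pred i : qt i = D * qt (ord_pred i).
Proof. by rewrite -(qt_dual i) -mulgA qt2 mulg1. Qed.

Lemma qtE (i : 'I_e) : qt i = D ^+ i * tau.
Proof.
case: i => n; elim: n => [|n IH] ltn.
  by rewrite mul1g; congr presented_gen; congr oplus_t; apply: val_inj.
have /= {}IH := IH (ltnW ltn).
rewrite qt_pred /= expgS -(mulgA D) -IH; congr (_ * qt _).
by apply: val_inj; apply: (@val_ord_pred e (Ordinal ltn)).
Qed.

(** Going once around the cycle with [qt_pred] gives [tau = D ^+ e * tau]. *)
Lemma Q_De : D ^+ e = 1.
Proof.
apply: (mulIg tau); rewrite mul1g [RHS]qt_pred qtE mulgA -expgS.
by rewrite /= add0n modn_small ?prednK.
Qed.

Lemma Q_tauD : tau * D = D^-1 * tau.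
Proof.
have tD : tau * D = qt (ord_pred i0) by rewrite /D mulgA qt2 mul1g.
apply: (mulgI D); rewrite mulVKg tD -qt_pred //.
Qed.

Lemma Q_tpow a : exists i : 'I_e, D ^+ a * tau = qt i.
Proof.
exists (Ordinal (ltn_pmod a e_gt0)); rewrite qtE /= {1}(divn_eq a e).
by rewrite addnC expgnDr mulnC expgnA Q_De expg1n mulg1.
Qed.

Lemma qsE n : 0 < n -> n < r -> exists2 j : sidx r.+1,
  val j = n.+2 & qs n = presented_gen R (oplus_s e j).
Proof.
move=> n0 nr; have jP : 3 <= n.+2 <= r.+1 by lia.
by exists (Sub n.+2 jP); rewrite ?SubK // /qs insubT.
Qed.

Lemma Q_qs2 n : 0 < n -> n.+1 < r.+1 -> qs n * qs n = 1.
Proof. by move=> n0 nr; have [j _ ->] := qsE n0 nr; apply: Q_square. Qed.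

Lemma Q_braid n : 0 < n -> n.+2 < r.+1 ->
  qs n * qs n.+1 * qs n = qs n.+1 * qs n * qs n.+1.
Proof.
move=> n0 nr; have [i iE ->] := qsE n0 (ltnW nr).
have [j jE ->] := qsE (ltn0Sn n) nr.
have ij : `|val i - val j|%N = 1%N by rewrite iE jE; lia.
by have := Q_oplus (oplus_R1 e ij); rewrite !prod_seqE.
Qed.

Lemma Q_comm m n : 0 < m -> m.+1 < n -> n.+1 < r.+1 -> commute (qs m) (qs n).
Proof.
move=> m0 mn nr.
have [i iE ->] : exists2 j, val j = m.+2 & qs m = presented_gen R (oplus_s e j).
  by apply: qsE => //; lia.
have [j jE ->] : exists2 j, val j = n.+2 & qs n = presented_gen R (oplus_s e j).
  by apply: qsE => //; lia.
have ij : 1 < `|val i - val j|%N by rewrite iE jE; lia.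
by have := Q_oplus (oplus_R2 e ij); rewrite !prod_seqE.
Qed.

Lemma Q_s1_braid : 2 < r.+1 -> forall a,
  qs 1 * (D ^+ a * tau) * qs 1 = (D ^+ a * tau) * qs 1 * (D ^+ a * tau).
Proof.
move=> r2 a; have [i ->] := Q_tpow a; have [j jE ->] := qsE (ltn0Sn 0) r2.
by have := Q_oplus (oplus_R3 i jE); rewrite !prod_seqE.
Qed.

Lemma Q_comm_t n i : 1 < n -> n.+1 < r.+1 -> commute (qs n) (qt i).
Proof.
move=> n1 nr; have [j jE ->] := qsE (ltnW n1) nr.
have j4 : 4 <= val j by rewrite jE.
by have := Q_oplus (oplus_R4 i j4); rewrite !prod_seqE.
Qed.

Lemma Q_commD n : 1 < n -> n.+1 < r.+1 -> commute (qs n) D.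
Proof. by move=> n1 nr; apply: commuteM; apply: Q_comm_t. Qed.

(** Each generator is its own inverse, so the signs of the letters of a word may be dropped. *)
Lemma Q_parabolic (q : Q) : parabolic D tau qs r.+1 q.
Proof.
have [w ->] := presented_word q; elim: w => [|[x b] w IH].
  by rewrite /word_eval big_nil; apply: parabolic1.
rewrite -cat1s word_eval_cat word_eval_letter /=.
have -> : (if b then presented_gen R x else (presented_gen R x)^-1)
          = presented_gen R x.
  by case: b => //; apply: mulg1_eq; apply: Q_square.
case: x => [i|[j jP]].
  rewrite -[presented_gen _ _]/(qt i) qtE; apply: parabolic_t => //.
  by exists (i : nat).
have [n0 nr] : 0 < j - 2 /\ j - 2 < r by lia.
have [k kE] := qsE n0 nr.
have -> : k = exist _ j jP by apply: val_inj; rewrite kE /=; lia.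
by move=> <-; apply: parabolic_s => //; lia.
Qed.

Let act (q : Q) := @Geer_act C e r.+1 (proj q).
Let E (n : nat) : 'cV[C]_r.+1 := basis_vec C (coord n).

Lemma Q_actM g h v : act (g * h) v = act g (act h v).
Proof. by rewrite /act /proj (presented_liftM satG) Geer_actM. Qed.

Lemma Q_act1 v : act 1 v = v.
Proof. by rewrite /act /proj (presented_lift1 satG) Geer_act1. Qed.

Lemma Q_actZ g c v : act g (c *: v)%R = (c *: act g v)%R.
Proof. exact: Geer_actZ. Qed.

Lemma Q_act_t i : act (qt i) =1 Geer_act (refl e (coord 0) (coord 1) (z ^+ i)%R).
Proof. by move=> v; rewrite /act /proj (presented_lift_gen satG). Qed.

Lemma Q_act_s n : 0 < n -> n < r ->
  act (qs n) =1 Geer_act (refl e (coord n) (coord n.+1) 1%R).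
Proof.
move=> n0 nr v; have [j jE ->] := qsE n0 nr.
by rewrite /act /proj (presented_lift_gen satG) /= jE subSS subn1.
Qed.

Lemma E_free i j c : i < r.+1 -> j < r.+1 -> E i = (c *: E j)%R -> i = j /\ c = 1%R.
Proof.
move=> ir jr /basis_vec_free[ij ->]; split=> //; apply/eqP.
by rewrite -coord_eq // ij.
Qed.

Let c01 : coord 0 != coord 1. Proof. by rewrite coord_eq. Qed.

Lemma Q_act_t0 i : act (qt i) (E 0) = (z ^+ i *: E 1)%R.
Proof. by rewrite Q_act_t refl_left ?rootX // root_neq0 ?rootX. Qed.

Lemma Q_act_t1 i : act (qt i) (E 1) = (z ^- i *: E 0)%R.
Proof. by rewrite Q_act_t refl_right ?rootX // root_neq0 ?rootX. Qed.

Lemma Q_act_tn i n : 1 < n -> n < r.+1 -> act (qt i) (E n) = E n.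
Proof.
move=> n1 nr; rewrite Q_act_t refl_other ?rootX ?coord_eq // ?root_neq0 ?rootX //.
  by lia.
by lia.
Qed.

Let zpred : (z * z ^+ ord_pred i0 = 1)%R.
Proof. by rewrite -expr_ord_pred expr0. Qed.

Lemma Q_actD0 : act D (E 0) = (z^-1 *: E 0)%R.
Proof.
rewrite /D Q_actM Q_act_t0 Q_actZ Q_act_t1 scalerA expr0 invr1 mulr1.
by congr (_ *: _)%R; rewrite -[RHS]mulr1 -zpred mulKf // root_neq0.
Qed.

Lemma Q_actD1 : act D (E 1) = (z *: E 1)%R.
Proof.
rewrite /D Q_actM Q_act_t1 Q_actZ Q_act_t0 scalerA expr0 mulr1.
congr (_ *: _)%R; apply: (canLR (@invrK _)); rewrite -[RHS]mulr1 -zpred mulKf //.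
exact: root_neq0.
Qed.

Lemma Q_actDn n : 1 < n -> n < r.+1 -> act D (E n) = E n.
Proof. by move=> n1 nr; rewrite Q_actM !Q_act_tn. Qed.

Lemma Q_act_tau1 : act tau (E 1) = E 0.
Proof. by rewrite Q_act_t1 expr0 invr1 scale1r. Qed.

Section ActS.
Variable n : nat.
Hypotheses (n0 : 0 < n) (nr : n.+1 < r.+1).

Let cn : coord n != coord n.+1.
Proof. by rewrite coord_eq //; lia. Qed.

Lemma Q_act_s0 : act (qs n) (E n) = E n.+1.
Proof. by rewrite Q_act_s // refl_left ?expr1n ?oner_neq0 ?scale1r. Qed.

Lemma Q_act_sn j : j < r.+1 -> j != n -> j != n.+1 -> act (qs n) (E j) = E j.
Proof.
move=> jr jn jn1; rewrite Q_act_s // refl_other ?expr1n ?oner_neq0 //.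
  by rewrite coord_eq // ltnW.
by rewrite coord_eq.
Qed.

End ActS.

Lemma Q_injective q : proj q = 1 -> q = 1.
Proof.
move=> q1; refine (parabolic_faithful e_gt0 Q_De (qt2 i0) Q_tauD Q_qs2 Q_braid
  Q_comm Q_s1_braid Q_commD (fun n => @Q_comm_t n i0) z_prim Q_actM Q_act1 Q_actZ
  E_free Q_actD0 Q_actD1 Q_actDn Q_act_tau1 (@Q_act_tn i0)
  Q_act_s0 Q_act_sn _ _ (Q_parabolic q) _) => // j _.
by rewrite /act q1 Geer_act1.
Qed.

(** An element [g] with the same effect as [A] on [E m.+1], and fixing the later vectors, is
    supplied by [frame_surjective]; then [(proj g)^-1 * A] fixes one more vector. *)
Lemma Q_surjective_step m (A : Geer C e r.+1) : m <= r ->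
  (forall j, m < j -> j < r.+1 -> Geer_act A (E j) = E j) -> exists q, proj q = A.
Proof.
elim: m A => [|m IH] A mr AE.
  exists 1; rewrite /proj (presented_lift1 satG); apply/esym.
  apply: (@Geer_fix_but_one _ _ _ (coord 0)) => j j0.
  have -> : j = coord j by rewrite /coord inord_val.
  apply: AE => //; rewrite lt0n; apply: contraNneq j0 => j0.
  by rewrite -val_eqE /= inordK // j0.
have [s [c [AM ce _]]] := Geer_act_monomial A.
have EV (i : 'I_r.+1) : basis_vec C i = E i by rewrite /E /coord inord_val.
(* The later coordinates are fixed, so the permutation cannot send [m.+1] to one of them. *)
have im : s (coord m.+1) <= m.+1.
  rewrite leqNgt; apply/negP => mi; have := AE _ mi (ltn_ord _).
  rewrite -EV AM => /esym/basis_vec_free[/perm_inj sE _].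
  by move: mi; rewrite -sE inordK ?ltnn.
have [g [gE gfix]] := frame_surjective e_gt0 Q_s1_braid z_prim Q_actM Q_act1
  Q_actZ Q_actD0 Q_actD1 Q_actDn Q_act_tau1 (@Q_act_tn i0) Q_act_s0 Q_act_sn
  (ltn0Sn m) mr im (ce (coord m.+1)).
have [j|q qE] := IH ((proj g)^-1 * A) (ltnW mr); last first.
  by exists (g * q); rewrite /proj (presented_liftM satG) -/proj qE mulVKg.
rewrite leq_eqVlt => /orP[/eqP <-|mj] jr; rewrite Geer_actM.
  by rewrite AM EV -gE -Geer_actM mulVg Geer_act1.
by rewrite AE // -{1}(gfix j mj jr) -Geer_actM mulVg Geer_act1.
Qed.

Lemma Geer_presentation : is_presentation R oplus_to_Geer.
Proof.
apply: (presentation_of_lift satG) => [A|q]; last exact: Q_injective.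
by apply: (@Q_surjective_step r A) => // j; lia.
Qed.

End ReflectionPresentation.

(** * Primitive roots of unity and the final assembly *)

(** The polynomial ['X^n - 1] splits and is separable in characteristic 0, so it has [n] distinct
    roots; among [n] distinct [n]-th roots of unity one is primitive. *)
Lemma primitive_root_exists (C : numClosedFieldType) (n : nat) :
  0 < n -> exists z : C, (n.-primitive_root z)%R.
Proof.
move=> n_gt0; pose p : {poly C} := ('X^n - 1)%R.
have [s Dp] := closed_field_poly_normal p.
rewrite (monicP _) ?monicXnsubC // scale1r in Dp.
have rootp : all (n.-unity_root)%R s.
  by apply/allP=> z; rewrite -root_prod_XsubC -Dp.
have size_s : n < (size s).+1.
  by rewrite -(size_prod_XsubC s id) -Dp size_XnsubC.
have [|z _] := hasP (has_prim_root n_gt0 rootp _ size_s); last by exists z.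
by rewrite -separable_prod_XsubC -Dp separable_Xn_sub_1 // pnatr_eq0 -lt0n.
Qed.

Local Close Scope group_scope.

Theorem theorem2p1 (R : realType) (e r : nat) (he : (1 <= e)%N) (hr : (2 <= r)%N) :
  (exists f : oplus_gen e r -> braid_group e r,
     [/\ (forall i : 'I_e, i = 0 %[mod e] -> f (oplus_t r i) = braid_gen e bmr_t0),
         (forall i : 'I_e, i = 1 %[mod e] -> f (oplus_t r i) = braid_gen e bmr_t1),
         (forall j : sidx r, f (oplus_s e j) = braid_gen e (bmr_s j)),
         (forall i : 'I_e, (2 <= i)%N ->
            f (oplus_t r i) =
            (f (oplus_t r (ord_pred i)) *
             f (oplus_t r (ord_pred (ord_pred i))) *
             (f (oplus_t r (ord_pred i)))^-1)%g) &
         is_presentation (@oplus_rel e r) f])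
  /\
  (exists f : oplus_gen e r -> reflection_group R e r,
     is_presentation (add_squares (@oplus_rel e r)) f /\
     (forall a : oplus_gen e r, is_reflection (f a))).
Proof.
split; first exact: braid_presentation.
have [z z_prim] := primitive_root_exists R[i] he.
case: r hr => // r' r'_gt0; exists (@oplus_to_Geer _ e r' z); split.
  exact: Geer_presentation.
move=> a; have [i [j [c [-> ij ce c0]]]] := oplus_to_Geer_refl he r'_gt0 z_prim a.
exact: refl_is_reflection.
Qed.
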